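(* For each $n\in\mathbb{N}$, let $C_n$ be the number of weak-Schreier subsets of $\{1,2,\ldots,n\}$ (including the empty set), and let $E_n$ be the number of Zeckendorf subsets of $\{1,2,\ldots,n\}$ (including the empty set). Then $C_n=E_n$ for each $n\in\mathbb{N}$.
   Context: $\mathbb{N}=\{1,2,3,\ldots\}$. A nonempty finite set $S\subseteq\mathbb{N}$ is weak-Schreier if $\min S\ge |S|$; the empty set is counted as weak-Schreier. A finite set of natural numbers is Zeckendorf if it does not contain two consecutive natural numbers. *)

(* Defs.v *)
From mathcomp Require Import all_boot finmap.

Set Implicit Arguments.
Unset Strict Implicit.
Unset Printing Implicit Defensive.

Local Open Scope fset_scope.

(* Minimum of a nonempty finite set; the junk value on the empty set is 0. *)
Definition fset_min (S : {fset nat}) : nat :=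
  head 0 (sort leq (enum_fset S)).

Lemma fset_minP (S : {fset nat}) : S != fset0 ->
  fset_min S \in S /\ (forall x, x \in S -> fset_min S <= x).
Proof.
move=> S0; rewrite /fset_min.
have memE x : (x \in sort leq (enum_fset S)) = (x \in S) by rewrite mem_sort.
have := sort_sorted leq_total (enum_fset S).
case: (sort _ _) memE => [memE _|y s memE] /=.
  by case/fset0Pn: S0 => x; rewrite -memE.
move/(order_path_min leq_trans)/allP => ys.
split; first by rewrite -memE mem_head.
by move=> x; rewrite -memE inE => /orP[/eqP->|/ys].
Qed.

Definition weak_schreier (S : {fset nat}) : bool :=
  (S == fset0) || (#|` S| <= fset_min S).

Definition zeckendorf (S : {fset nat}) : bool :=
  ~~ has (fun x => x.+1 \in S) (enum_fset S).

(* {1, ..., n}: the arguments of iota are the first term and the length. *)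
Definition initial_segment (n : nat) : {fset nat} := [fset x in iota 1 n].

Definition C_ (n : nat) : nat :=
  #|` [fset S in fpowerset (initial_segment n) | weak_schreier S]|.

Definition E_ (n : nat) : nat :=
  #|` [fset S in fpowerset (initial_segment n) | zeckendorf S]|.

(* Main.v *)
Require Import Defs.
From mathcomp Require Import all_boot finmap.

(* Both counts satisfy the Fibonacci recurrence a(n+2) = a(n+1) + a(n): the
   admissible subsets of {1..n+2} that avoid n+2 are those of {1..n+1}, and
   those that contain n+2 are in bijection with the admissible subsets of
   {1..n}, via S |-> S + {n+2} in the Zeckendorf case and
   S |-> (S shifted up by 1) + {n+2} in the weak-Schreier case. *)

Local Open Scope fset_scope.
Local Open Scope nat_scope.

(** [C_] and [E_] unfold to the cardinality of this set for their respective predicates, so one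
    recurrence lemma serves both. *)
Definition subsets_such_that (P : pred {fset nat}) (n : nat) :
    {fset {fset nat}} :=
  [fset S in fpowerset (initial_segment n) | P S].

Lemma mem_initial_segment n x : (x \in initial_segment n) = (0 < x <= n).
Proof. by rewrite !inE /= mem_iota add1n ltnS. Qed.

Lemma mem_subsets_such_that P n S :
  S \in subsets_such_that P n = (S `<=` initial_segment n) && P S.
Proof. by rewrite !inE fpowersetE. Qed.

Lemma sub_initial_segmentP n (S : {fset nat}) :
  reflect (forall x, x \in S -> 0 < x <= n) (S `<=` initial_segment n).
Proof.
apply: (iffP (@fsubsetP _ _ _)) => sS x /sS; by rewrite mem_initial_segment.
Qed.

Lemma sub_initial_segmentS n (S : {fset nat}) :
  (S `<=` initial_segment n.+1) && (n.+1 \notin S) =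
  (S `<=` initial_segment n).
Proof.
apply/andP/sub_initial_segmentP => [[/sub_initial_segmentP sS nS] x xS|sS].
  have /andP[-> /=] := sS x xS; rewrite leq_eqVlt ltnS => /predU1P[xE|//].
  by rewrite -xE xS in nS.
split; last by apply/negP => /sS; rewrite ltnn andbF.
by apply/sub_initial_segmentP => x /sS /andP[-> /leqW].
Qed.

Lemma card_sub_initial_segment n (S : {fset nat}) :
  S `<=` initial_segment n -> #|` S| <= n.
Proof.
move=> /fsubset_leq_card /leq_trans; apply.
by rewrite card_fseq (leq_trans (size_undup _)) ?size_iota.
Qed.

(** The image of [h] is the part of the family at [n.+2] whose members contain [n.+2]; injectivity
    gives its size, and the members outside it form exactly the family at [n.+1]. *)
Lemma card_subsets_rec (P : pred {fset nat}) (h : {fset nat} -> {fset nat}) n :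
    {in subsets_such_that P n &, injective h} ->
    (forall T, (T \in subsets_such_that P n.+2) && (n.+2 \in T) =
               (T \in h @` subsets_such_that P n)) ->
  #|` subsets_such_that P n.+2| =
  #|` subsets_such_that P n.+1| + #|` subsets_such_that P n|.
Proof.
move=> hI hE; pose B := h @` subsets_such_that P n.
have cB : #|` B| = #|` subsets_such_that P n| by apply: card_in_imfset.
have eD : subsets_such_that P n.+2 `\` B = subsets_such_that P n.+1.
  apply/fsetP => T.
  rewrite in_fsetD -hE !mem_subsets_such_that -(@sub_initial_segmentS n.+1).
  by case: (T `<=` _); case: (P T); case: (_ \in T).
have eI : subsets_such_that P n.+2 `&` B = B.
  by apply/fsetP => T; rewrite in_fsetI -hE andbA andbb.
by rewrite -(cardfsID B) eI eD cB addnC.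
Qed.

Lemma zeckendorfP (S : {fset nat}) :
  reflect (forall x, x \in S -> x.+1 \notin S) (zeckendorf S).
Proof. by rewrite /zeckendorf -all_predC; apply: allP. Qed.

(** Bounding every element instead of the minimum absorbs the empty set, so the default value of
    [fset_min] never enters the later arguments. *)
Lemma weak_schreierP (S : {fset nat}) :
  reflect (forall x, x \in S -> #|` S| <= x) (weak_schreier S).
Proof.
rewrite /weak_schreier; have [->|S0] := eqVneq S fset0; first by left.
have [mS minS] := fset_minP S0.
by apply: (iffP idP) => [Sm x /minS|]; [apply: leq_trans | apply].
Qed.

Lemma E_rec n : E_ n.+2 = E_ n.+1 + E_ n.
Proof.
apply: (@card_subsets_rec zeckendorf (fun S => n.+2 |` S)) => [S T|T].
  rewrite !mem_subsets_such_that => /andP[sS _] /andP[sT _] eST.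
  have nin U : U `<=` initial_segment n -> n.+2 \notin U.
    move=> /sub_initial_segmentP sU.
    by apply/negP => /sU /=; rewrite ltnNge leqnSn.
  by rewrite -(fsetU1K (nin S sS)) eST fsetU1K ?nin.
apply/andP/imfsetP => /= [[]|[S + ->]]; rewrite mem_subsets_such_that.
  move=> /andP[/sub_initial_segmentP sT /zeckendorfP zT] nT.
  exists (T `\ n.+2); last by rewrite fsetD1K.
  rewrite mem_subsets_such_that; apply/andP; split.
    apply/sub_initial_segmentP => x; rewrite !inE => /andP[xn xT].
    have /andP[-> /=] := sT x xT; rewrite leq_eqVlt (negPf xn) /= ltnS.
    rewrite leq_eqVlt ltnS => /predU1P[xE|//].
    (* The value [n.+1] is excluded because its successor [n.+2] lies in [T]. *)
    by have := zT x xT; rewrite xE nT.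
  apply/zeckendorfP => x; rewrite !inE => /andP[_ /zT].
  by rewrite negb_and orbC => ->.
move=> /andP[/sub_initial_segmentP sS /zeckendorfP zS]; rewrite fset1U1.
rewrite mem_subsets_such_that; split=> //; apply/andP; split.
  apply/sub_initial_segmentP => x; rewrite !inE => /predU1P[->|/sS].
    by rewrite /= leqnn.
  by case/andP=> -> xn; rewrite !leqW.
apply/zeckendorfP => x; rewrite !inE => /predU1P[->|xS]; rewrite negb_or.
  rewrite gtn_eqF //=.
  by apply/negP => /sS /=; rewrite ltnNge ltnW // ltnW.
(* Elements of [S] are at most [n], so their successors stay below [n.+2]. *)
by rewrite zS // andbT ltn_eqF // ltnS; have /andP[_ ] := sS x xS.
Qed.

Lemma C_rec n : C_ n.+2 = C_ n.+1 + C_ n.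
Proof.
pose h (S : {fset nat}) := n.+2 |` (succn @` S).
have nin S : S `<=` initial_segment n -> n.+2 \notin succn @` S.
  move=> /sub_initial_segmentP sS.
  by apply/imfsetP => -[x /sS /andP[_ xn] [xE]]; rewrite -xE ltnn in xn.
have cardh S : S `<=` initial_segment n -> #|` h S| = #|` S|.+1.
  by move=> sS; rewrite cardfsU1 nin // card_imfset //; apply: succn_inj.
apply: (@card_subsets_rec weak_schreier h) => [S T|T].
  rewrite !mem_subsets_such_that => /andP[sS _] /andP[sT _] eST.
  have : succn @` S = succn @` T.
    by rewrite -(fsetU1K (nin S sS)) -/(h S) eST fsetU1K ?nin.
  move=> /fsetP eST'; apply/fsetP => x.
  by have := eST' x.+1; rewrite !(mem_imfset _ _ succn_inj).
apply/andP/imfsetP => /= [[]|[S + ->]]; rewrite mem_subsets_such_that.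
  move=> /andP[/sub_initial_segmentP sT /weak_schreierP wT] nT.
  have cT : #|` T| = #|` T `\ n.+2|.+1 by rewrite (cardfsD1 n.+2) nT.
  (* A second element besides [n.+2] forces [T] to have at least two elements, hence every element
     to be at least 2. This makes the downward shift injective and keeps it positive. *)
  have gt1 x : x \in T `\ n.+2 -> 1 < x.
    move=> xT; apply: leq_trans (wT x _); last by case/fsetD1P: xT.
    by rewrite cT ltnS cardfs_gt0; apply/fset0Pn; exists x.
  pose S := predn @` (T `\ n.+2).
  have SE : succn @` S = T `\ n.+2.
    apply/fsetP => x; apply/imfsetP/idP => /= [[_ /imfsetP[/= y yT ->] ->]|xT].
      by rewrite prednK // ltnW // gt1.
    exists x.-1; first by apply/imfsetP; exists x.
    by rewrite prednK // ltnW // gt1.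
  have TE : T = h S by rewrite /h SE fsetD1K.
  have sS : S `<=` initial_segment n.
    apply/sub_initial_segmentP => _ /imfsetP[/= y yT ->].
    have := gt1 y yT; case/fsetD1P: yT => yn /sT /andP[_].
    (* Here [y] lies between 2 and [n.+1], so its predecessor lies between 1 and [n]. *)
    by rewrite leq_eqVlt (negPf yn) /=; case: y {yn} => [|[|y]].
  exists S; rewrite // mem_subsets_such_that sS /=.
  (* Both sides grow by one: [T] has one element more than [S], and [x.+1] belongs to [T]. *)
  apply/weak_schreierP => x xS; rewrite -ltnS -cardh // -TE wT // TE.
  by rewrite fset1Ur // mem_imfset //; apply: succn_inj.
move=> /andP[sS /weak_schreierP wS]; rewrite fset1U1.
rewrite mem_subsets_such_that; split=> //; apply/andP; split.
  apply/sub_initial_segmentP => x; rewrite !inE => /predU1P[->|].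
    by rewrite /= leqnn.
  move=> /imfsetP[/= y yS ->]; move/sub_initial_segmentP: sS => /(_ y yS).
  by case/andP=> _ yn; rewrite /= ltnS leqW.
apply/weak_schreierP => x; rewrite cardh // !inE => /predU1P[->|].
  (* The new element [n.+2] is large enough since [S] has at most [n] elements. *)
  by rewrite ltnS leqW // card_sub_initial_segment.
by move=> /imfsetP[/= y yS ->]; rewrite ltnS wS.
Qed.

(** The only possible element is 1, so every subset satisfies both conditions. *)
Lemma C_E_base n : n <= 1 -> C_ n = E_ n.
Proof.
move=> n1.
suff eS : subsets_such_that weak_schreier n = subsets_such_that zeckendorf n.
  exact: (congr1 (fun A : {fset {fset nat}} => #|` A|) eS).
apply/fsetP => S; rewrite !mem_subsets_such_that.
have [sS|//] := boolP (S `<=` _); move/sub_initial_segmentP: (sS) => S1.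
have eq1 x : x \in S -> x = 1.
  by move=> /S1 /andP[x0 /leq_trans/(_ n1) x1]; apply/eqP; rewrite eqn_leq x1.
have -> : weak_schreier S.
  apply/weak_schreierP => x /eq1 ->.
  exact: leq_trans (card_sub_initial_segment _ _ sS) n1.
by apply/esym/zeckendorfP => x /eq1 ->; apply/negP => /eq1.
Qed.

Theorem theorem3 : forall n : nat, 0 < n -> C_ n = E_ n.
Proof.
(* The recurrence reaches back two steps, so the value at 2 also relies on the base case 0. *)
move=> n _; elim/ltn_ind: n => -[|[|n]] IHn; [exact: C_E_base..|].
by rewrite C_rec E_rec !IHn.
Qed.
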